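(* Let $M$ be a connected paving matroid not isomorphic to $U_{1,1}$. Then $$\frac{2}{3}\mu(M)\le \eta(M)\le 2\mu(M).$$
   Context: Matroids are finite, and connected matroids are understood to have nonempty ground set. $U_{1,1}$ is the one-element rank-$1$ uniform matroid. A matroid $M$ of rank $r(M)$ is paving if every circuit of $M$ has size at least $r(M)$. A join of a matroid $M$ on ground set $E(M)$ is a set $J\subseteq E(M)$ with $|J\cap C|\le |C|/2$ for every circuit $C$ of $M$. $\mu(M)$ is the maximum size of a join. Ear decompositions: for a nonempty sequence of circuits $C_1,\dots,C_t$ of $M$ put $D_0=\varnothing$ and $D_i=C_1\cup\dots\cup C_i$. The sequence is an ear decomposition of $M$ if $D_t=E(M)$ and for every $i\ge 2$: (E1) $C_i\cap D_{i-1}\neq\varnothing$; (E2) $C_i\setminus D_{i-1}\ne\varnothing$; (E3) no circuit $C$ of $M$ with $C\cap D_{i-1}\neq\varnothing$ and $C\setminus D_{i-1}\neq\varnothing$ has $C\setminus D_{i-1}$ properly contained in $C_i\setminus D_{i-1}$. The set $P_i=C_i\setminus D_{i-1}$ is the $i$th lobe; it is odd or even according to the parity of $|P_i|$. $\varphi(M)$ is the minimum number of even lobes over all ear decompositions of $M$. For a connected matroid $M$ not isomorphic to $U_{1,1}$, an ear decomposition exists, and $\eta(M):=\frac{r(M)+\varphi(M)}{2}$, where $r(M)$ is the rank. *)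

(* Defs.v *)
From HB Require Import structures.
From mathcomp Require Import all_boot all_order all_algebra.

Set Implicit Arguments.
Unset Strict Implicit.
Unset Printing Implicit Defensive.

Import Order.TTheory GRing.Theory Num.Theory.

(* A finite matroid whose ground set E(M) is the whole finite type T. *)
Record matroid (T : finType) := Matroid {
  indep : pred {set T};
  indep0 : indep set0;
  indepS : forall I J : {set T}, I \subset J -> indep J -> indep I;
  indep_aug : forall I J : {set T}, indep I -> indep J -> #|I| < #|J| ->
    exists2 x, x \in J :\: I & indep (x |: I)
}.

Definition circuit (T : finType) (M : matroid T) (C : {set T}) : bool :=
  minset (fun X : {set T} => ~~ indep M X) C.

Definition rank (T : finType) (M : matroid T) : nat :=
  \max_(I : {set T} | indep M I) #|I|.

Definition connected (T : finType) (M : matroid T) : Prop :=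
  0 < #|T| /\
  forall x y : T, x != y -> exists C, [/\ circuit M C, x \in C & y \in C].

Definition paving (T : finType) (M : matroid T) : Prop :=
  forall C, circuit M C -> rank M <= #|C|.

Definition isomorphic (S T : finType) (M : matroid S) (N : matroid T) : Prop :=
  exists2 f : S -> T, bijective f &
    forall I : {set S}, indep N (f @: I) = indep M I.

Section Uniform.
Variables r n : nat.
Let uindep : pred {set 'I_n} := fun I => #|I| <= r.

Fact uindep0 : uindep set0.
Proof. by rewrite /uindep cards0. Qed.

Fact uindepS (I J : {set 'I_n}) : I \subset J -> uindep J -> uindep I.
Proof. by move=> /subset_leq_card; apply: leq_trans. Qed.

Fact uindep_aug (I J : {set 'I_n}) : uindep I -> uindep J -> #|I| < #|J| ->
  exists2 x, x \in J :\: I & uindep (x |: I).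
Proof.
move=> _ Jr ltIJ; have /subsetPn[x xJ xI] : ~~ (J \subset I).
  by apply: contraL ltIJ => /subset_leq_card; rewrite -leqNgt.
exists x; first by rewrite inE xI.
by rewrite /uindep cardsU1 xI; apply: leq_trans Jr.
Qed.

Definition uniform_matroid : matroid 'I_n :=
  Matroid uindep0 uindepS uindep_aug.

End Uniform.

Definition is_join (T : finType) (M : matroid T) (J : {set T}) : bool :=
  [forall C : {set T}, circuit M C ==> (2 * #|J :&: C| <= #|C|)].

Definition mu (T : finType) (M : matroid T) : nat :=
  \max_(J : {set T} | is_join M J) #|J|.

(* The sequence C_1, ..., C_t is s with 0-based indices, so that C_(i+1) is
   nth set0 s i, D_i is ear_union s i and the lobe P_(i+1) is lobe s i. *)
Definition ear_union (T : finType) (s : seq {set T}) (i : nat) : {set T} :=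
  \bigcup_(C <- take i s) C.

Definition lobe (T : finType) (s : seq {set T}) (i : nat) : {set T} :=
  nth set0 s i :\: ear_union s i.

Definition ear_step (T : finType) (M : matroid T) (D C : {set T}) : bool :=
  [&& C :&: D != set0, C :\: D != set0 &
      ~~ [exists C' : {set T}, [&& circuit M C', C' :&: D != set0,
            C' :\: D != set0 & (C' :\: D) \proper (C :\: D)]]].

Definition ear_decomposition (T : finType) (M : matroid T)
    (s : seq {set T}) : bool :=
  [&& s != [::], all (circuit M) s, ear_union s (size s) == [set: T] &
      [forall i : 'I_(size s),
         (0 < i) ==> ear_step M (ear_union s i) (nth set0 s i)]].

Definition even_lobes (T : finType) (s : seq {set T}) : nat :=
  #|[set i : 'I_(size s) | ~~ odd #|lobe s i|]|.

(* Every ear decomposition has at most #|T| lobes, so bounding the length loses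
   nothing and the default value #|T| never affects the minimum; see
   [varphi_le] and [varphi_attained]. *)
Definition varphi (T : finType) (M : matroid T) : nat :=
  \big[minn/#|T|]_(n < #|T|.+1)
    \big[minn/#|T|]_(s : n.-tuple {set T} | ear_decomposition M s)
      even_lobes s.

Definition eta (T : finType) (M : matroid T) : rat :=
  ((rank M + varphi M)%:R / 2%:R)%R.

Section VarphiTheory.
Variables (T : finType) (M : matroid T).
Implicit Types s : seq {set T}.

Lemma ear_unionS s i : i < size s ->
  ear_union s i.+1 = ear_union s i :|: nth set0 s i.
Proof.
by move=> lti; rewrite /ear_union (take_nth set0 lti) -cats1 big_cat big_seq1.
Qed.

Lemma ear_decomposition_size s : ear_decomposition M s -> size s <= #|T|.
Proof.
case/and4P=> _ /allP circ _ /forallP step.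
suff le_card i : i <= size s -> i <= #|ear_union s i|.
  exact: leq_trans (le_card _ (leqnn _)) (max_card _).
elim: i => // i IHi lti; apply: leq_ltn_trans (IHi (ltnW lti)) _.
rewrite ear_unionS //; apply: proper_card; rewrite properUl //.
rewrite -setD_eq0; case: (posnP i) => [i0|i_gt0].
  rewrite i0 /ear_union take0 big_nil setD0; apply/eqP => C0.
  have /circ : nth set0 s i \in s by rewrite mem_nth.
  by rewrite i0 C0 => /minsetp; rewrite indep0.
by have /implyP/(_ i_gt0)/and3P[] := step (Ordinal lti).
Qed.

Lemma even_lobes_le s : ear_decomposition M s -> even_lobes s <= #|T|.
Proof.
move/ear_decomposition_size; apply: leq_trans.
by rewrite -[leqRHS]card_ord max_card.
Qed.

Lemma varphi_le s : ear_decomposition M s -> varphi M <= even_lobes s.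
Proof.
move=> ears; have lts : size s < #|T|.+1 by apply: ear_decomposition_size.
rewrite /varphi -minEnat -leEnat.
apply: (@bigmin_inf _ _ _ _ (Ordinal lts)) => //=.
exact: (@bigmin_inf _ _ _ _ (in_tuple s)).
Qed.

Lemma varphi_attained s0 : ear_decomposition M s0 ->
  exists2 s, ear_decomposition M s & varphi M = even_lobes s.
Proof.
move=> ears0; have varphi_s0 := varphi_le ears0.
have [eqT|] : varphi M = #|T| \/
    exists2 s, ear_decomposition M s & varphi M = even_lobes s; last by [].
  pose K k := k = #|T| \/ exists2 s, ear_decomposition M s & k = even_lobes s.
  have Kmin a b : K a -> K b -> K (minn a b) by rewrite /minn; case: ifP.
  apply: (big_ind K) => [|//|n _]; first by left.
  by apply: (big_ind K) => [|//|s ears]; [left | right; exists (val s)].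
exists s0 => //; apply/eqP; rewrite eqn_leq varphi_s0 eqT.
exact: even_lobes_le.
Qed.

End VarphiTheory.

(* Main.v *)
Require Import Defs.
From mathcomp Require Import all_boot all_order all_algebra.
From mathcomp Require Import zify lra.
Import Order.TTheory GRing.Theory Num.Theory.

Set Implicit Arguments.
Unset Strict Implicit.
Unset Printing Implicit Defensive.

(** Write r for the rank and n for the size of the ground set. The statement is
    4 mu <= 3 (r + phi) together with r + phi <= 4 mu, and it holds because in a
    paving matroid both mu and phi are almost determined by r. Take n > 1
    first; by connectivity there are then no loops.

    Joins. All circuits have size r or r + 1. Hence every set of size at most
    r/2 is a join ([paving_mu_ge]). Conversely, a join J can be enlarged to a
    set X of size r + 1; a circuit C inside X omits at most r + 1 - |C| elements
    of J, and |J n C| <= |C|/2 then gives |J| <= r + 1 - |C|/2 <= r/2 + 1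
    ([paving_mu_le]). So mu lies between r/2, rounded down, and r/2 + 1.

    Even lobes. A lobe P_i with i >= 2 and at least two elements increases the
    rank: if some x in it were spanned by an independent subset of D_(i-1), a
    circuit through x whose other elements lie in D_(i-1) would contradict
    (E3) ([ear_step_indep]). Even lobes have at least two elements, and D_1, a
    circuit, already has rank at least r - 1, so at most one even lobe follows
    the first lobe; and if there is one, D_1 has rank r - 1, that is |C_1| = r.
    Hence every ear decomposition has at most two even lobes, and at most one
    when r is odd ([paving_even_lobes]). An ear decomposition exists by greedy
    extension ([ear_decomposition_exists]).

    These estimates give the upper bound once mu > 0 is used for r = 1, and the
    lower bound for all r >= 3. For r = 2 connectivity improves mu <= 2 to
    mu <= 1 ([connected_mu_rank2]), and for r = 1 the first lobe is a circuit of
    size 2, whence phi >= 1 ([varphi_gt0_rank1]). Finally, if n = 1 then M is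
    U_{1,1} or a loop, and for a loop r, mu and phi all vanish. *)

(** * Finite sets and circuits *)

Lemma exists_superset_card (T : finType) (A : {set T}) k :
  #|A| <= k <= #|T| -> exists2 X : {set T}, A \subset X & #|X| = k.
Proof.
case/andP=> leAk lekT; pose B := [set x in take (k - #|A|) (enum (~: A))].
have BA x : x \in B -> x \notin A.
  by rewrite inE => /mem_take; rewrite mem_enum inE.
exists (A :|: B); first exact: subsetUl.
rewrite cardsU (_ : A :&: B = set0) ?cards0 ?subn0; last first.
  apply/setP => x; rewrite in_setI in_set0.
  by apply/negP => /andP[xA /BA]; rewrite xA.
have -> : #|B| = k - #|A|.
  rewrite /B cardsE (card_uniqP (take_uniq _ (enum_uniq _))) size_takel //.
  by rewrite -cardE; have := cardsC A; lia.
by rewrite subnKC.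
Qed.

Lemma indep_card_rank (T : finType) (M : matroid T) I :
  indep M I -> #|I| <= rank M.
Proof. by move=> indI; apply: leq_bigmax_cond. Qed.

Lemma dep_circuit (T : finType) (M : matroid T) X :
  ~~ indep M X -> exists2 C, circuit M C & C \subset X.
Proof.
by move/(@minset_exists T (fun X : {set T} => ~~ indep M X)) => [C]; exists C.
Qed.

Lemma circuit_not_sub_indep (T : finType) (M : matroid T) C I :
  circuit M C -> indep M I -> ~~ (C \subset I).
Proof. by move/minsetp=> depC indI; apply: contra depC => /indepS->. Qed.

Lemma circuit_neq0 (T : finType) (M : matroid T) C : circuit M C -> C != set0.
Proof.
by move/circuit_not_sub_indep => /(_ _ (indep0 M)); rewrite subset0.
Qed.

Lemma circuit_indepD1 (T : finType) (M : matroid T) C c :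
  circuit M C -> c \in C -> indep M (C :\ c).
Proof.
move=> circC cC; apply/negPn/negP => depCc.
have /setP/(_ c) := minsetinf circC depCc (subD1set C c).
by rewrite !inE eqxx cC.
Qed.

Lemma circuit_card_rank (T : finType) (M : matroid T) C :
  circuit M C -> #|C| <= (rank M).+1.
Proof.
move=> circC; have /set0Pn[c cC] := circuit_neq0 circC.
have := indep_card_rank (circuit_indepD1 circC cC).
by rewrite (cardsD1 c C) cC.
Qed.

(** A loop is a circuit, and it is properly contained in any circuit joining it
    to a second element. *)
Lemma connected_loopless (T : finType) (M : matroid T) :
  connected M -> 1 < #|T| -> forall x, indep M [set x].
Proof.
case=> _ connM ltT x; apply/negPn/negP => /dep_circuit[C circC sCx].
have [y] : exists y, y \in [set~ x].
  by apply/set0Pn; rewrite -card_gt0 cardsC1; lia.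
rewrite !inE eq_sym => neqxy; have [C' [circC' xC' yC']] := connM x y neqxy.
have sCC' : C \subset C' by apply: subset_trans sCx _; rewrite sub1set.
have eqCC' := minsetinf circC' (minsetp circC) sCC'.
by move/subsetP/(_ y): sCx; rewrite eqCC' inE eq_sym (negPf neqxy) => /(_ yC').
Qed.

Lemma loopless_circuit_card (T : finType) (M : matroid T) C :
  (forall x, indep M [set x]) -> circuit M C -> 1 < #|C|.
Proof.
move=> loopless circC; have := circuit_neq0 circC; rewrite -card_gt0.
rewrite leq_eqVlt => /predU1P[/esym/eqP/cards1P[x eqC]|//].
by have := circuit_not_sub_indep circC (loopless x); rewrite eqC subxx.
Qed.

Lemma dependent_rank_lt (T : finType) (M : matroid T) :
  ~~ indep M [set: T] -> rank M < #|T|.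
Proof.
move=> depT; have : 0 < #|indep M|.
  by apply/card_gt0P; exists set0; apply: indep0.
case/(eq_bigmax_cond (fun I : {set T} => #|I|)) => I indI eqI.
rewrite /rank eqI -cardsT; apply: proper_card; rewrite properT.
by apply: contraTneq indI => ->.
Qed.

(** * Joins *)

Lemma join_le_mu (T : finType) (M : matroid T) J : is_join M J -> #|J| <= mu M.
Proof. by move=> joinJ; apply: leq_bigmax_cond. Qed.

Lemma mu_attained (T : finType) (M : matroid T) :
  exists2 J, is_join M J & mu M = #|J|.
Proof.
have join0 : is_join M set0.
  by apply/forallP => C; apply/implyP => _; rewrite set0I cards0 muln0.
have : 0 < #|is_join M| by apply/card_gt0P; exists set0.
by case/(eq_bigmax_cond (fun J : {set T} => #|J|)) => J; exists J.
Qed.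

Lemma join_indep (T : finType) (M : matroid T) J : is_join M J -> indep M J.
Proof.
move/forallP=> joinJ; apply/negPn/negP => /dep_circuit[C circC sCJ].
have /implyP/(_ circC) := joinJ C.
by have := circuit_neq0 circC; rewrite (setIidPr sCJ) -card_gt0; lia.
Qed.

Lemma mu_rank (T : finType) (M : matroid T) : mu M <= rank M.
Proof. by apply/bigmax_leqP => J /join_indep; apply: indep_card_rank. Qed.

(** A set of size at most r/2 meets each circuit in at most half of the
    circuit's r or more elements. *)
Lemma paving_mu_ge (T : finType) (M : matroid T) :
  paving M -> (rank M)./2 <= mu M.
Proof.
move=> pavM; have leT : rank M <= #|T|.
  by apply/bigmax_leqP => I _; apply: max_card.
have [|J _ cardJ] := @exists_superset_card T set0 (rank M)./2.
  by rewrite cards0; lia.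
rewrite -cardJ; apply: join_le_mu.
apply/forallP => C; apply/implyP => /pavM leC.
by have := subset_leq_card (subsetIl J C); lia.
Qed.

(** Any r + 1 elements contain a circuit, so a join J is enlarged to such a set
    X and tested against a circuit C inside X: nearly all of X, hence of J, lies
    in C. *)
Lemma paving_mu_le (T : finType) (M : matroid T) :
  paving M -> rank M < #|T| -> 2 * mu M <= rank M + 2.
Proof.
move=> pavM ltT; have [J joinJ eqJ] := mu_attained M.
have leJ := indep_card_rank (join_indep joinJ).
have [|X sJX cardX] := @exists_superset_card T J (rank M).+1; first by lia.
have /dep_circuit[C circC sCX] : ~~ indep M X.
  by apply/negP => /indep_card_rank; lia.
have /forallP/(_ C)/implyP/(_ circC) := joinJ.
have leDX : #|J :\: C| <= #|X| - #|C|.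
  by rewrite -cardsDS //; apply/subset_leq_card/setSD.
have := cardsID C J; have := pavM C circC; have := subset_leq_card sCX; lia.
Qed.

(** This improves on r/2 rounded down when r = 1. *)
Lemma loopless_mu_gt0 (T : finType) (M : matroid T) :
  (forall x, indep M [set x]) -> 0 < #|T| -> 0 < mu M.
Proof.
move=> loopless /card_gt0P[x _]; rewrite -(cards1 x); apply: join_le_mu.
apply/forallP => C; apply/implyP => /(loopless_circuit_card loopless).
by have := subset_leq_card (subsetIl [set x] C); rewrite cards1; lia.
Qed.

(** Two elements of a join lie in a common circuit, which would have to have
    size at least 4, whereas circuits have size at most r + 1 = 3. *)
Lemma connected_mu_rank2 (T : finType) (M : matroid T) :
  connected M -> rank M = 2 -> mu M <= 1.
Proof.
case=> _ connM rk2; have [J joinJ ->] := mu_attained M.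
rewrite leqNgt; apply/negP => /card_gt1P[x [y [xJ yJ neqxy]]].
have [C [circC xC yC]] := connM x y neqxy.
have /forallP/(_ C)/implyP/(_ circC) := joinJ.
have gt1 : 1 < #|J :&: C| by apply/card_gt1P; exists x, y; rewrite !inE xJ yJ.
by have := circuit_card_rank circC; lia.
Qed.

(** * Ear decompositions *)

(** An ear decomposition of a part of the ground set: the invariant of the
    greedy construction. *)
Definition partial_ears (T : finType) (M : matroid T) (s : seq {set T}) :=
  [/\ s != [::], all (circuit M) s &
    forall i, 0 < i < size s -> ear_step M (ear_union s i) (nth set0 s i)].

Lemma ear_decompositionP (T : finType) (M : matroid T) s :
  reflect (partial_ears M s /\ ear_union s (size s) = [set: T])
          (ear_decomposition M s).
Proof.
apply: (iffP and4P) => [[s0 circ /eqP full /forallP step]|].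
  split=> //; split=> // i /andP[i0 lti].
  by have /implyP/(_ i0) := step (Ordinal lti).
case=> [[s0 circ step] full]; split=> //; first exact/eqP.
by apply/forallP => i; apply/implyP => i0; apply: step; rewrite i0 ltn_ord.
Qed.

Lemma ear_union_mono (T : finType) (s : seq {set T}) i j :
  i <= j -> ear_union s i \subset ear_union s j.
Proof.
move=> leij; rewrite /ear_union -[take j s](cat_take_drop i) take_takel //.
by rewrite big_cat subsetUl.
Qed.

Lemma ear_union1 (T : finType) (s : seq {set T}) :
  s != [::] -> ear_union s 1 = nth set0 s 0.
Proof.
move=> s0; rewrite ear_unionS ?lt0n ?size_eq0 //.
by rewrite /ear_union take0 big_nil set0U.
Qed.

Lemma lobe0 (T : finType) (s : seq {set T}) : lobe s 0 = nth set0 s 0.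
Proof. by rewrite /lobe /ear_union take0 big_nil setD0. Qed.

(** Connectivity yields a circuit crossing from D to its complement; one that
    adds as few elements as possible satisfies (E3). *)
Lemma ear_step_exists (T : finType) (M : matroid T) D :
  connected M -> D != set0 -> D != [set: T] ->
  exists2 C, circuit M C & ear_step M D C.
Proof.
case=> _ connM /set0Pn[y yD]; rewrite -subTset => /subsetPn[x _ xD].
have [|C0 [circC0 xC0 yC0]] := connM x y.
  by apply: contraNneq xD => ->.
pose crosses C := [&& circuit M C, C :&: D != set0 & C :\: D != set0].
have crossC0 : crosses C0.
  apply/and3P; split=> //; apply/set0Pn; first by exists y; rewrite inE yC0.
  by exists x; rewrite inE xD.
case: (@arg_minnP _ C0 crosses (fun C => #|C :\: D|) crossC0) => C.
case/and3P=> circC CD CnD minC; exists C => //; apply/and3P; split=> //.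
apply/existsP => -[C' /and4P[circC' C'D C'nD /proper_card]].
by rewrite ltnNge minC //; apply/and3P.
Qed.

Lemma partial_ears_rcons (T : finType) (M : matroid T) s C :
  partial_ears M s -> circuit M C -> ear_step M (ear_union s (size s)) C ->
  partial_ears M (rcons s C).
Proof.
case=> s0 circ step circC stepC; split; first by case: (s).
  by rewrite all_rcons circC.
have prefix i : i <= size s -> ear_union (rcons s C) i = ear_union s i.
  by move=> lei; rewrite /ear_union -cats1 takel_cat.
move=> i; rewrite size_rcons ltnS => /andP[i0 lei]; rewrite prefix // nth_rcons.
case: ltngtP lei => // [lti _|-> _ //].
by apply: step; rewrite i0.
Qed.

Lemma partial_ears_extend (T : finType) (M : matroid T) s :
  connected M -> partial_ears M s -> exists s', ear_decomposition M s'.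
Proof.
move=> connM; have [k] := ubnP #|~: ear_union s (size s)|.
elim: k s => // k IHk s ltk ears.
set D := ear_union s (size s) in ltk *.
have [full|notfull] := eqVneq D [set: T].
  by exists s; apply/ear_decompositionP.
have [s0 /allP circ _] := ears.
have size_s : 0 < size s by rewrite lt0n size_eq0.
have D0 : D != set0.
  have /circ/circuit_neq0 : nth set0 s 0 \in s by rewrite mem_nth.
  apply: contraNneq => D_eq0; rewrite -subset0 -ear_union1 //.
  by apply: subset_trans (ear_union_mono s size_s) _; rewrite -/D D_eq0.
have [C circC stepC] := ear_step_exists connM D0 notfull.
apply: IHk (partial_ears_rcons ears circC stepC).
apply: leq_trans (_ : #|~: D| <= k); last by rewrite -ltnS.
apply: proper_card; rewrite size_rcons ear_unionS ?size_rcons //.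
rewrite /ear_union -cats1 takel_cat // -/(ear_union s _) -/D.
rewrite cats1 nth_rcons ltnn eqxx properC properUl //.
by have /and3P[_] := stepC; rewrite -setD_eq0.
Qed.

Lemma ear_decomposition_exists (T : finType) (M : matroid T) C :
  connected M -> circuit M C -> exists s, ear_decomposition M s.
Proof.
move=> connM circC; apply: (@partial_ears_extend _ _ [:: C] connM).
by split=> //= [|[|i]]; rewrite ?circC ?andbF.
Qed.

(** * Even lobes *)

(** Otherwise some circuit C' inside x |: I passes through x; as {x} is
    independent, C' also meets D. It adds only x to D, whereas C adds x and
    more, contrary to (E3). *)
Lemma ear_step_indep (T : finType) (M : matroid T) D C (I : {set T}) x :
  (forall y, indep M [set y]) -> ear_step M D C -> 1 < #|C :\: D| ->
  x \in C :\: D -> I \subset D -> indep M I -> indep M (x |: I).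
Proof.
move=> loopless /and3P[_ _ /existsPn minC] gt1 xCD sID indI.
apply/negPn/negP => /dep_circuit[C' circC' sC'].
have {minC}/negP := minC C'; apply.
have xD : x \notin D by case/setDP: xCD.
have xC' : x \in C'.
  have /subsetPn[y yC' yI] := circuit_not_sub_indep circC' indI.
  by have := subsetP sC' y yC'; rewrite in_setU1 (negPf yI) orbF => /eqP <-.
have sC'D : C' :\: D \subset [set x].
  apply/subsetP => y /setDP[/(subsetP sC')]; rewrite in_setU1 inE.
  by case/predU1P=> [->|/(subsetP sID) ->].
apply/and4P; split=> //.
- have /subsetPn[y yC' yx] := circuit_not_sub_indep circC' (loopless x).
  apply/set0Pn; exists y; rewrite inE yC' (subsetP sID) //.
  by have := subsetP sC' y yC'; rewrite in_setU1 -in_set1 (negPf yx).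
- by apply/set0Pn; exists x; rewrite inE xD.
rewrite properEcard (subset_trans sC'D) ?sub1set //=.
by apply: leq_ltn_trans (subset_leq_card sC'D) _; rewrite cards1.
Qed.

(** A nonempty even lobe has at least two elements, so it strictly increases the
    rank of the union of the ears. *)
Lemma even_lobe_extends_indep (T : finType) (M : matroid T) s i (I : {set T}) :
  (forall y, indep M [set y]) -> ear_decomposition M s ->
  0 < i < size s -> ~~ odd #|lobe s i| ->
  I \subset ear_union s i -> indep M I ->
  exists I' : {set T},
    [/\ I' \subset ear_union s i.+1, indep M I' & #|I'| = #|I|.+1].
Proof.
move=> loopless /ear_decompositionP[[_ _ step] _] iP even_i sI indI.
have stepi := step i iP; have /and3P[_ lobe_n0 _] := stepi.
have /set0Pn[x xi] := lobe_n0.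
have gt1 : 1 < #|lobe s i|.
  by move: lobe_n0 even_i; rewrite -/(lobe s i) -card_gt0; case: #|_| => [|[]].
exists (x |: I); split.
- case/andP: iP => _ lti; rewrite ear_unionS // subUset sub1set.
  by case/setDP: xi => xi _; rewrite inE xi orbT subsetU // sI.
- exact: ear_step_indep stepi gt1 xi sI indI.
rewrite cardsU1 (contra (subsetP sI x)) //.
by case/setDP: xi.
Qed.

(** Counting the rank: the first circuit minus an element is independent of size
    at least r - 1, and each later even lobe enlarges it by one. *)
Lemma paving_even_lobes (T : finType) (M : matroid T) s :
  paving M -> (forall y, indep M [set y]) -> ear_decomposition M s ->
  even_lobes s + odd (rank M) <= 2.
Proof.
move=> pavM loopless ears.
have [[s0 /allP circ _] _] := ear_decompositionP _ _ ears.
pose C := nth set0 s 0.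
have circC : circuit M C by rewrite circ // mem_nth // lt0n size_eq0.
have /set0Pn[c cC] := circuit_neq0 circC.
have leC := pavM C circC; have indI := circuit_indepD1 circC cC.
have cardI : #|C| = #|C :\ c|.+1 by rewrite (cardsD1 c C) cC.
have sI i : 0 < i -> C :\ c \subset ear_union s i.
  move=> i0; apply: subset_trans (subD1set _ _) _.
  by rewrite /C -ear_union1 // ear_union_mono.
pose even := [set i : 'I_(size s) | ~~ odd #|lobe s i|].
pose first := [set i : 'I_(size s) | i == 0 :> nat].
(* Two later even lobes would produce an independent set of size at least
   (r - 1) + 2. *)
have no_two (i j : 'I_(size s)) : i < j -> i \in even :\: first ->
    j \in even :\: first -> False.
  move=> ltij /setDP[]; rewrite !inE -!lt0n => even_i i0 /andP[j0 even_j].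
  have iP : 0 < i < size s by rewrite i0 /=.
  have jP : 0 < j < size s by rewrite j0 /=.
  have [I1 [sI1 indI1 cardI1]] :=
    even_lobe_extends_indep loopless ears iP even_i (sI i i0) indI.
  have [I2 [_ /indep_card_rank]] := even_lobe_extends_indep loopless ears jP
    even_j (subset_trans sI1 (ear_union_mono _ ltij)) indI1.
  by lia.
have late_le1 : #|even :\: first| <= 1.
  apply/card_le1_eqP => i j late_i late_j; apply/val_inj.
  case: (ltngtP i j) => // /no_two; first by move/(_ late_i late_j).
  by move/(_ late_j late_i).
have early_le1 : #|even :&: first| <= 1.
  apply/card_le1_eqP => i j /setIP[_]; rewrite inE => /eqP i0 /setIP[_].
  by rewrite inE => /eqP j0; apply/val_inj; rewrite /= i0 j0.
(* One later even lobe forces |C| = r, so for odd r the first lobe is odd. *)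
have odd_rank : odd (rank M) -> #|even :\: first| + #|even :&: first| <= 1.
  move=> odd_r; have [->|] := posnP #|even :\: first|; first by [].
  rewrite card_gt0 => /set0Pn[i /setDP[]]; rewrite !inE -lt0n => even_i i0.
  have iP : 0 < i < size s by rewrite i0 /=.
  have [I1 [_ /indep_card_rank leI1 cardI1]] :=
    even_lobe_extends_indep loopless ears iP even_i (sI i i0) indI.
  have eqC : #|C| = rank M by lia.
  rewrite (_ : even :&: first = set0) ?cards0 ?addn0 //.
  apply/setP => j; rewrite !inE; apply/negP => /andP[even_j /eqP j0].
  by move: even_j; rewrite j0 lobe0 -/C eqC odd_r.
have := cardsID first even.
rewrite /even_lobes -/even.
by case: (odd (rank M)) odd_rank => [/(_ isT)|_]; lia.
Qed.

(** Every first lobe is a circuit, of size exactly 2 in this case. *)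
Lemma varphi_gt0_rank1 (T : finType) (M : matroid T) s :
  (forall y, indep M [set y]) -> ear_decomposition M s -> rank M = 1 ->
  0 < varphi M.
Proof.
move=> loopless /varphi_attained[{}s ears ->] rk1.
have [[s0 /allP circ _] _] := ear_decompositionP _ _ ears.
have size_s : 0 < size s by rewrite lt0n size_eq0.
have circC : circuit M (nth set0 s 0) by rewrite circ // mem_nth.
rewrite /even_lobes card_gt0; apply/set0Pn; exists (Ordinal size_s).
rewrite inE /= lobe0; set C := nth set0 s 0 in circC *.
suff -> : #|C| = 2 by [].
have := loopless_circuit_card loopless circC; have := circuit_card_rank circC.
by rewrite rk1; lia.
Qed.

(** * One-element matroids and the integer bounds *)

Lemma singleton_isomorphic_U11 (T : finType) (M : matroid T) :
  #|T| = 1 -> indep M [set: T] -> isomorphic M (uniform_matroid 1 1).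
Proof.
move=> T1 indT; exists (fun=> ord0).
  have /eqP/fintype1P[x xT] := T1.
  by exists (fun=> x) => y; rewrite ?ord1 ?[y]xT.
move=> I; rewrite (indepS (subsetT I) indT); apply: leq_trans (max_card _) _.
by rewrite card_ord.
Qed.

Lemma loop_invariants (T : finType) (M : matroid T) :
  #|T| = 1 -> ~~ indep M [set: T] ->
  [/\ rank M = 0, mu M = 0 & varphi M = 0].
Proof.
move=> T1 depT; have rk0 : rank M = 0 by have := dependent_rank_lt depT; lia.
split=> //; first by have := mu_rank M; lia.
have [C circC _] := dep_circuit depT.
have eqC : C = [set: T].
  apply/eqP; rewrite eqEcard subsetT cardsT T1 card_gt0.
  exact: circuit_neq0 circC.
have union : ear_union [:: C] 1 = C by rewrite ear_union1.
have ears : ear_decomposition M [:: C].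
  apply/ear_decompositionP; rewrite /= union; split=> //.
  by split=> //= [|[|i]]; rewrite ?circC ?andbF.
apply/eqP; rewrite -leqn0; apply: leq_trans (varphi_le ears) _.
rewrite leqn0 cards_eq0; apply/eqP/setP => i.
by rewrite !inE (ord1 i) lobe0 /= eqC cardsT T1.
Qed.

Lemma paving_bounds (T : finType) (M : matroid T) :
  connected M -> paving M -> 1 < #|T| ->
  4 * mu M <= 3 * (rank M + varphi M) /\ rank M + varphi M <= 4 * mu M.
Proof.
move=> connM pavM gt1; have loopless := connected_loopless connM gt1.
have /card_gt1P[x [y [_ _ neqxy]]] : 1 < #|[set: T]| by rewrite cardsT.
have [C [circC _ _]] := connM.2 x y neqxy.
have rank_gt0 : 0 < rank M.
  by have := indep_card_rank (loopless x); rewrite cards1.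
have ltT : rank M < #|T|.
  apply: dependent_rank_lt; apply: contraL (subsetT C).
  exact: circuit_not_sub_indep.
have [s ears] := ear_decomposition_exists connM circC.
have phi_le := varphi_le ears.
have lobes_le := paving_even_lobes pavM loopless ears.
have mu_ge := paving_mu_ge pavM; have mu_le := paving_mu_le pavM ltT.
have mu_gt0 := loopless_mu_gt0 loopless (ltnW gt1).
split; last by lia.
(* For r = 3 the lower bound relies on rounding: 2 mu <= 5 gives mu <= 2. *)
have [rk1|rk_neq1] := eqVneq (rank M) 1.
  by have := varphi_gt0_rank1 loopless ears rk1; lia.
have [rk2|rk_neq2] := eqVneq (rank M) 2; last by lia.
by have := connected_mu_rank2 connM rk2; lia.
Qed.

Unset Implicit Arguments.

Theorem theorem4p5 (T : finType) (M : matroid T)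
    (connM : connected M) (pavM : paving M)
    (nU11 : ~ isomorphic M (uniform_matroid 1 1)) :
  (2%:R / 3%:R * (mu M)%:R <= eta M <= 2%:R * (mu M)%:R)%R.
Proof.
have [lower upper] :
    4 * mu M <= 3 * (rank M + varphi M) /\ rank M + varphi M <= 4 * mu M.
  have [gt1|le1] := ltnP 1 #|T|; first exact: paving_bounds.
  have T1 : #|T| = 1 by have := connM.1; lia.
  have /(loop_invariants T1)[-> -> ->] : ~~ indep M [set: T].
    by apply/negP => /(singleton_isomorphic_U11 T1).
  by [].
move: lower upper; rewrite /eta -!(ler_nat rat) !natrM.
by move=> lower upper; apply/andP; split; lra.
Qed.
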